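(* Let $L$ be a nilpotent, finite-dimensional diassociative algebra over a field $\mathbb{F}$. Then $$\dim\mathcal{H}^2(L,\mathbb{F})\le\dim\mathcal{H}^2(L/L',\mathbb{F})+\dim(L')\bigl[4\dim(L/Z(L))-4\dim((L/Z(L))')-1\bigr].$$
   Context: A diassociative algebra $L$ over a field $\mathbb{F}$ is an $\mathbb{F}$-vector space with two associative bilinear products $\dashv,\vdash$ satisfying $x\dashv(y\dashv z)=x\dashv(y\vdash z)$, $(x\vdash y)\dashv z=x\vdash(y\dashv z)$, $(x\dashv y)\vdash z=(x\vdash y)\vdash z$ for all $x,y,z\in L$. The center $Z(L)$ is the set of $z\in L$ with $z\dashv x=z\vdash x=x\dashv z=x\vdash z=0$ for all $x\in L$. For subalgebras $X,Y$ of $L$, $X\lozenge Y=X\dashv Y+X\vdash Y$, where $X\dashv Y$ and $X\vdash Y$ are the spans of the corresponding products. For any diassociative algebra $Q$, $Q'=Q\lozenge Q$. The lower central series is $L^1=L$, $L^{k+1}=L^1\lozenge L^k+L^2\lozenge L^{k-1}+\cdots+L^k\lozenge L^1$; $L$ is nilpotent if $L^k=0$ for some $k$. For a diassociative algebra $Q$ over $\mathbb{F}$, $\mathcal{Z}^2(Q,\mathbb{F})$ is the space of pairs $(f_{\dashv},f_{\vdash})$ of bilinear forms $Q\times Q\to\mathbb{F}$ such that for all $i,j,k\in Q$: $f_{\dashv}(i,j\dashv k)=f_{\dashv}(i,j\vdash k)$; $f_{\dashv}(i\vdash j,k)=f_{\vdash}(i,j\dashv k)$; $f_{\vdash}(i\dashv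 j,k)=f_{\vdash}(i\vdash j,k)$; $f_{\dashv}(i,j\dashv k)=f_{\dashv}(i\dashv j,k)$; $f_{\vdash}(i,j\vdash k)=f_{\vdash}(i\vdash j,k)$. $\mathcal{B}^2(Q,\mathbb{F})$ is the subspace of pairs for which there is a linear map $\varepsilon:Q\to\mathbb{F}$ with $f_{\dashv}(x,y)=-\varepsilon(x\dashv y)$ and $f_{\vdash}(x,y)=-\varepsilon(x\vdash y)$ for all $x,y$; and $\mathcal{H}^2(Q,\mathbb{F})=\mathcal{Z}^2(Q,\mathbb{F})/\mathcal{B}^2(Q,\mathbb{F})$. *)

(* Defs.v *)
From HB Require Import structures.
From mathcomp Require Import all_boot all_order all_algebra.
From mathcomp Require Import boolp.

Set Implicit Arguments.
Unset Strict Implicit.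
Unset Printing Implicit Defensive.

Import GRing.Theory.
Local Open Scope ring_scope.
Local Open Scope quotient_scope.

Reserved Notation "x ⊣ y" (at level 40, left associativity).
Reserved Notation "x ⊢ y" (at level 40, left associativity).
Reserved Notation "X ◊ Y" (at level 40, left associativity).

(* {vspace V} only has spans of finite sequences; vspan P is the span of the
   set of all vectors satisfying P, which need not be decidable. *)
Section Vspan.
Variables (F : fieldType) (V : vectType F).
Implicit Types (P Q : V -> Prop) (U W : {vspace V}).

Definition lin_closed Q :=
  Q 0 /\ forall (a : F) u v, Q u -> Q v -> Q (a *: u + v).

Lemma vspan_exists P : exists U : {vspace V},
  (forall v, P v -> v \in U) /\
  (forall Q, lin_closed Q -> (forall v, P v -> Q v) ->
   forall v, v \in U -> Q v).
Proof.
suff ext n : forall U : {vspace V}, (\dim {:V} - \dim U < n)%N ->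
    (forall Q, lin_closed Q -> (forall v, P v -> Q v) ->
     forall v, v \in U -> Q v) ->
    exists U : {vspace V}, (forall v, P v -> v \in U) /\
    (forall Q, lin_closed Q -> (forall v, P v -> Q v) ->
     forall v, v \in U -> Q v).
  apply: (ext _ 0%VS (leqnn _)) => Q [Q0 _] _ v.
  by rewrite memv0 => /eqP ->.
elim: n => [//|n IHn] U ltn minU.
have [allU|/existsNP[v /not_implyP[Pv /negP vU]]] :=
  pselect (forall v, P v -> v \in U); first by exists U.
apply: (IHn (U + <[v]>)%VS); last first.
  move=> Q Qlin sPQ _ /memv_addP[u uU [_ /vlineP[k ->] ->]].
  by rewrite addrC; apply: Qlin.2; [apply: sPQ | apply: minU Qlin sPQ _ uU].
have ltU : (\dim U < \dim (U + <[v]>))%N.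
  rewrite ltn_neqAle dimvS ?addvSl // andbT.
  apply: contra vU => /eqP eqd.
  have /eqP -> : U == (U + <[v]>)%VS by rewrite eqEdim addvSl -eqd leqnn.
  by rewrite memvE addvSr.
have leV : (\dim (U + <[v]>) <= \dim {:V})%N by rewrite dimvS ?subvf.
by apply: leq_trans (ltn_sub2l (leq_trans ltU leV) ltU) _.
Qed.

Definition vspan P : {vspace V} := sval (cid (vspan_exists P)).

Lemma mem_vspan P v : P v -> v \in vspan P.
Proof. by rewrite /vspan; case: cid => U [sPU _] /=; apply: sPU. Qed.

Lemma vspan_ind P Q : lin_closed Q -> (forall v, P v -> Q v) ->
  forall v, v \in vspan P -> Q v.
Proof. by rewrite /vspan; case: cid => U [_ minU] /=; apply: minU. Qed.

Lemma vspan_subv P W : (forall v, P v -> v \in W) -> (vspan P <= W)%VS.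
Proof.
move=> sPW; apply/subvP; apply: vspan_ind sPW.
by split=> [|a u v Wu Wv]; rewrite ?mem0v // memvD ?memvZ.
Qed.

Lemma vspanP P v : lin_closed P -> (v \in vspan P <-> P v).
Proof. by move=> Plin; split=> [|/mem_vspan//]; apply: vspan_ind. Qed.

End Vspan.

(* The space of cosets of U; it is built on the Z-module Quotient.quot U. *)
Definition vquot (F : fieldType) (V : vectType F) (U : {vspace V}) : Type :=
  Quotient.quot U.

Section VectorQuotient.
Variables (F : fieldType) (V : vectType F) (U : {vspace V}).
Local Notation Q := (vquot U).

HB.instance Definition _ := GRing.Zmodule.on Q.

Definition vpi (v : V) : Q := \pi_(Quotient.quot U) v.
Definition vrepr (q : Q) : V := repr (q : Quotient.quot U).

Lemma vreprK : cancel vrepr vpi.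
Proof. by move=> q; rewrite /vpi /vrepr reprK. Qed.

Lemma vpi_eq u v : vpi u = vpi v <-> u - v \in U.
Proof. by rewrite Quotient.idealrBE; split=> /eqP. Qed.

Lemma vrepr_pi v : vrepr (vpi v) - v \in U.
Proof. by apply/vpi_eq; rewrite vreprK. Qed.

Lemma vpiD u v : vpi (u + v) = vpi u + vpi v.
Proof. exact: (Quotient.pi_add U). Qed.

Definition vquot_scale (a : F) (q : Q) : Q := vpi (a *: vrepr q).

Lemma vpi_scale a v : vpi (a *: v) = vquot_scale a (vpi v).
Proof.
by apply/vpi_eq; rewrite -scalerBr memvZ // -opprB memvN vrepr_pi.
Qed.

Fact vquot_scaleA a b q :
  vquot_scale a (vquot_scale b q) = vquot_scale (a * b) q.
Proof. by rewrite -[q]vreprK -!vpi_scale scalerA. Qed.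

Fact vquot_scale1 : left_id 1 vquot_scale.
Proof. by move=> q; rewrite -[q]vreprK -vpi_scale scale1r. Qed.

Fact vquot_scaleDr : right_distributive vquot_scale +%R.
Proof.
move=> a p q; rewrite -[p]vreprK -[q]vreprK.
by rewrite -vpiD -!vpi_scale -vpiD scalerDr.
Qed.

Fact vquot_scaleDl q : {morph vquot_scale^~ q : a b / a + b}.
Proof. by move=> a b; rewrite -[q]vreprK -!vpi_scale -vpiD scalerDl. Qed.

HB.instance Definition _ := GRing.Zmodule_isLmodule.Build F Q
  vquot_scaleA vquot_scale1 vquot_scaleDr vquot_scaleDl.

Fact vpi_linear : linear vpi.
Proof. by move=> a u v; rewrite vpiD vpi_scale. Qed.
HB.instance Definition _ := GRing.isLinear.Build F V Q _ vpi vpi_linear.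

Lemma vpi_eq0 v : (vpi v == 0) = (v \in U).
Proof.
by apply/eqP/idP; rewrite -(linear0 vpi); rewrite vpi_eq subr0.
Qed.

(* Coordinates of a coset: those of its representative in U^C. *)
Fact vquot_vect_iso : Vector.axiom (\dim U^C) Q.
Proof.
pose p := daddv_pi U^C U.
have UC0 : (U^C :&: U = 0)%VS by rewrite capvC capv_compl.
have UC1 v : v \in (U^C + U)%VS by rewrite addvC addv_complf memvf.
have pB v : v - p v \in U.
  by rewrite -{1}(daddv_pi_add UC0 (UC1 v)) addrC addKr memv_pi.
have p0 v : v \in U -> p v = 0.
  move=> vU; apply/eqP; rewrite -memv0 -UC0 memv_cap memv_pi /=.
  by rewrite -[p v](subKr v) memvB.
have pK u v : u - v \in U -> p u = p v.
  by move=> /p0; rewrite linearB /= => /eqP; rewrite subr_eq0 => /eqP.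
pose f (q : Q) := \row_i coord (vbasis U^C) i (p (vrepr q)).
exists f.
  move=> a x y; apply/rowP=> i; rewrite !mxE -linearP /=.
  rewrite -linearP /=; congr (coord _ _ _); apply: pK.
  apply/vpi_eq; rewrite vreprK linearP /=.
  by rewrite !vreprK.
exists (fun r : 'rV_(\dim U^C) => vpi (\sum_i r 0 i *: (vbasis U^C)`_i)).
  move=> q; under eq_bigr do rewrite mxE.
  rewrite -coord_vbasis ?memv_pi // -[RHS]vreprK; apply/vpi_eq.
  by rewrite -opprB memvN.
move=> r; apply/rowP=> i; rewrite mxE.
set s := \sum_i _.
have sU : s \in U^C%VS.
  by apply: memv_suml => j _; rewrite memvZ // vbasis_mem // mem_nth ?size_tuple.
rewrite (pK _ s) ?vrepr_pi // /p daddv_pi_id //.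
by rewrite coord_sum_free // (basis_free (vbasisP _)).
Qed.
HB.instance Definition _ := Lmodule_hasFinDim.Build F Q vquot_vect_iso.

Lemma dim_vquot : \dim {: Q} = (\dim {: V} - \dim U)%N.
Proof. by rewrite dimvf /dim /= dimv_compl. Qed.

End VectorQuotient.

HB.mixin Record isDiassociative (F : fieldType) L of Vector F L := {
  ldia : L -> L -> L;
  rdia : L -> L -> L;
  ldia_linearl : forall y, linear (ldia^~ y);
  ldia_linearr : forall x, linear (ldia x);
  rdia_linearl : forall y, linear (rdia^~ y);
  rdia_linearr : forall x, linear (rdia x);
  ldiaA : associative ldia;
  rdiaA : associative rdia;
  ldia_lr : forall x y z, ldia x (ldia y z) = ldia x (rdia y z);
  rldiaA : forall x y z, ldia (rdia x y) z = rdia x (ldia y z);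
  rdia_lr : forall x y z, rdia (ldia x y) z = rdia (rdia x y) z
}.

(* Finite-dimensional diassociative algebras over F. *)
#[short(type="diassocType")]
HB.structure Definition Diassociative (F : fieldType) :=
  { L of isDiassociative F L & Vector F L }.

Notation "x ⊣ y" := (ldia x y) : ring_scope.
Notation "x ⊢ y" := (rdia x y) : ring_scope.

Section DiassociativeTheory.
Variables (F : fieldType) (L : diassocType F).
Implicit Types (x y z : L) (X Y I : {vspace L}).

Definition ldia_span X Y : {vspace L} :=
  vspan (fun z => exists x y, [/\ x \in X, y \in Y & z = x ⊣ y]).
Definition rdia_span X Y : {vspace L} :=
  vspan (fun z => exists x y, [/\ x \in X, y \in Y & z = x ⊢ y]).
Definition lozenge X Y : {vspace L} := (ldia_span X Y + rdia_span X Y)%VS.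
Local Notation "X ◊ Y" := (lozenge X Y).

Definition derived : {vspace L} := {:L} ◊ {:L}.

Definition central z :=
  forall x, [/\ z ⊣ x = 0, z ⊢ x = 0, x ⊣ z = 0 & x ⊢ z = 0].
Definition center : {vspace L} := vspan central.

(* [:: L^1; ...; L^n] *)
Fixpoint lcs_seq n : seq {vspace L} :=
  if n is n'.+1 then
    let s := lcs_seq n' in
    rcons s (if n' == 0%N then {:L}%VS
             else (\sum_(i < n') nth 0 s i ◊ nth 0 s (n' - i.+1))%VS)
  else [::].

(* The series is indexed from 1; lcs 0 is a junk value. *)
Definition lcs n : {vspace L} := nth {:L}%VS (lcs_seq n) n.-1.

Definition nilpotent := exists2 k, (0 < k)%N & lcs k = 0%VS.

Lemma size_lcs_seq n : size (lcs_seq n) = n.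
Proof. by elim: n => //= n IHn; rewrite size_rcons IHn. Qed.

Lemma nth_lcs_seq n i : (i < n)%N -> nth 0%VS (lcs_seq n) i = lcs i.+1.
Proof.
elim: n => [//|n IHn]; rewrite ltnS leq_eqVlt => /predU1P[->|ltin].
  by rewrite /lcs; apply: set_nth_default; rewrite size_lcs_seq.
by rewrite /= nth_rcons size_lcs_seq ltin IHn.
Qed.

Lemma lcs1 : lcs 1 = {:L}%VS. Proof. by []. Qed.

Lemma lcsS k : (0 < k)%N ->
  lcs k.+1 = (\sum_(1 <= i < k.+1) lcs i ◊ lcs (k.+1 - i))%VS.
Proof.
move=> k_gt0; rewrite /lcs /= nth_rcons size_lcs_seq ltnn eqxx.
rewrite eqn0Ngt k_gt0 /= big_add1 big_mkord; apply: eq_bigr => i _.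
rewrite !nth_lcs_seq //; last by rewrite ltn_subrL k_gt0.
by rewrite subSS subnSK.
Qed.

HB.instance Definition _ x := GRing.isLinear.Build F L L _ (ldia x)
  (@ldia_linearr F L x).
HB.instance Definition _ x := GRing.isLinear.Build F L L _ (rdia x)
  (@rdia_linearr F L x).

Lemma ldiaPl a x y z : (a *: x + y) ⊣ z = a *: (x ⊣ z) + y ⊣ z.
Proof. exact: ldia_linearl. Qed.

Lemma rdiaPl a x y z : (a *: x + y) ⊢ z = a *: (x ⊢ z) + y ⊢ z.
Proof. exact: rdia_linearl. Qed.

Lemma ldia0l y : 0 ⊣ y = 0 :> L.
Proof. by have := ldiaPl (-1) 0 0 y; rewrite scaler0 addr0 scaleN1r addNr. Qed.

Lemma rdia0l y : 0 ⊢ y = 0 :> L.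
Proof. by have := rdiaPl (-1) 0 0 y; rewrite scaler0 addr0 scaleN1r addNr. Qed.

Lemma ldiaBl x y z : (x - y) ⊣ z = x ⊣ z - y ⊣ z.
Proof. by rewrite addrC -scaleN1r ldiaPl scaleN1r addrC. Qed.

Lemma rdiaBl x y z : (x - y) ⊢ z = x ⊢ z - y ⊢ z.
Proof. by rewrite addrC -scaleN1r rdiaPl scaleN1r addrC. Qed.

Lemma centerP z : z \in center <-> central z.
Proof.
apply: vspanP; split=> [x|a u v Zu Zv x].
  by rewrite ldia0l rdia0l !linear0.
have [u1 u2 u3 u4] := Zu x; have [v1 v2 v3 v4] := Zv x.
by rewrite ldiaPl rdiaPl !linearP /= u1 u2 u3 u4 v1 v2 v3 v4 scaler0 addr0.
Qed.

Lemma mem_derived x y : x ⊣ y \in derived /\ x ⊢ y \in derived.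
Proof.
split; [apply: (subvP (addvSl _ _)) | apply: (subvP (addvSr _ _))];
  by apply: mem_vspan; exists x, y; rewrite !memvf.
Qed.

Definition is_ideal I := forall x y, y \in I ->
  [/\ x ⊣ y \in I, x ⊢ y \in I, y ⊣ x \in I & y ⊢ x \in I].

Record ideal := Ideal { ideal_vs :> {vspace L}; idealP : is_ideal ideal_vs }.

Fact derived_is_ideal : is_ideal derived.
Proof.
by move=> x y _; have [] := mem_derived x y; have [] := mem_derived y x.
Qed.
Definition derived_ideal := Ideal derived_is_ideal.

Fact center_is_ideal : is_ideal center.
Proof. by move=> x y /centerP/(_ x)[-> -> -> ->]; rewrite mem0v. Qed.
Definition center_ideal := Ideal center_is_ideal.

End DiassociativeTheory.

Arguments derived {F} L.
Arguments center {F} L.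
Arguments nilpotent {F} L.
Arguments ideal {F} L.
Arguments derived_ideal {F} L.
Arguments center_ideal {F} L.
Notation "X ◊ Y" := (lozenge X Y) : vspace_scope.

Definition diaquot (F : fieldType) (L : diassocType F) (I : ideal L) : Type :=
  vquot I.

Section DiassociativeQuotient.
Variables (F : fieldType) (L : diassocType F) (I : ideal L).
Local Notation Q := (diaquot I).

HB.instance Definition _ := Vector.on Q.

Definition diapi : L -> Q := @vpi F L I.
HB.instance Definition _ := GRing.Linear.on diapi.

Definition quot_ldia (p q : Q) : Q := diapi (vrepr p ⊣ vrepr q).
Definition quot_rdia (p q : Q) : Q := diapi (vrepr p ⊢ vrepr q).

Fact pi_ldia_subproof x y : diapi (x ⊣ y) = quot_ldia (diapi x) (diapi y).
Proof.
apply/esym/vpi_eq; set x' := vrepr _; set y' := vrepr _.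
rewrite -(subrKA (x ⊣ y')) -linearB -ldiaBl memvD //=.
  by have [] := idealP y' (vrepr_pi I x).
by have [] := idealP x (vrepr_pi I y).
Qed.

Fact pi_rdia_subproof x y : diapi (x ⊢ y) = quot_rdia (diapi x) (diapi y).
Proof.
apply/esym/vpi_eq; set x' := vrepr _; set y' := vrepr _.
rewrite -(subrKA (x ⊢ y')) -linearB -rdiaBl memvD //=.
  by have [] := idealP y' (vrepr_pi I x).
by have [] := idealP x (vrepr_pi I y).
Qed.

Let diareprK (q : Q) : diapi (vrepr q) = q := vreprK q.
Let piE := (pi_ldia_subproof, pi_rdia_subproof).

Fact quot_ldia_linearl q : linear (quot_ldia^~ q).
Proof.
move=> a x y; rewrite -[x]diareprK -[y]diareprK -[q]diareprK.
by rewrite -linearP -!piE ldiaPl linearP.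
Qed.
Fact quot_ldia_linearr q : linear (quot_ldia q).
Proof.
move=> a x y; rewrite -[x]diareprK -[y]diareprK -[q]diareprK.
by rewrite -linearP -!piE !linearP.
Qed.
Fact quot_rdia_linearl q : linear (quot_rdia^~ q).
Proof.
move=> a x y; rewrite -[x]diareprK -[y]diareprK -[q]diareprK.
by rewrite -linearP -!piE rdiaPl linearP.
Qed.
Fact quot_rdia_linearr q : linear (quot_rdia q).
Proof.
move=> a x y; rewrite -[x]diareprK -[y]diareprK -[q]diareprK.
by rewrite -linearP -!piE !linearP.
Qed.
Fact quot_ldiaA : associative quot_ldia.
Proof.
move=> x y z; rewrite -[x]diareprK -[y]diareprK -[z]diareprK.
by rewrite -!piE ldiaA.
Qed.
Fact quot_rdiaA : associative quot_rdia.
Proof.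
move=> x y z; rewrite -[x]diareprK -[y]diareprK -[z]diareprK.
by rewrite -!piE rdiaA.
Qed.
Fact quot_ldia_lr x y z :
  quot_ldia x (quot_ldia y z) = quot_ldia x (quot_rdia y z).
Proof.
by rewrite -[x]diareprK -[y]diareprK -[z]diareprK -!piE ldia_lr.
Qed.
Fact quot_rldiaA x y z :
  quot_ldia (quot_rdia x y) z = quot_rdia x (quot_ldia y z).
Proof.
by rewrite -[x]diareprK -[y]diareprK -[z]diareprK -!piE rldiaA.
Qed.
Fact quot_rdia_lr x y z :
  quot_rdia (quot_ldia x y) z = quot_rdia (quot_rdia x y) z.
Proof.
by rewrite -[x]diareprK -[y]diareprK -[z]diareprK -!piE rdia_lr.
Qed.

HB.instance Definition _ := isDiassociative.Build F Q
  quot_ldia_linearl quot_ldia_linearr quot_rdia_linearl quot_rdia_linearr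
  quot_ldiaA quot_rdiaA quot_ldia_lr quot_rldiaA quot_rdia_lr.

Lemma diapi_ldia x y : diapi (x ⊣ y) = diapi x ⊣ diapi y.
Proof. exact: pi_ldia_subproof. Qed.
Lemma diapi_rdia x y : diapi (x ⊢ y) = diapi x ⊢ diapi y.
Proof. exact: pi_rdia_subproof. Qed.
Lemma diapi_surj (q : Q) : exists x, q = diapi x.
Proof. by exists (vrepr q); rewrite diareprK. Qed.
Lemma diapi_eq0 x : (diapi x == 0) = (x \in I).
Proof. exact: vpi_eq0. Qed.
Lemma dim_diaquot : \dim {: Q} = (\dim {: L} - \dim I)%N.
Proof. exact: dim_vquot. Qed.

End DiassociativeQuotient.

Section Cohomology.
Variables (F : fieldType) (Q : diassocType F).

(* Bilinear forms on Q, curried; f i j is the value of the form at (i, j). *)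
Local Notation bilform := 'Hom(Q, 'Hom(Q, F^o)).
Local Notation formpair := (bilform * bilform)%type.
Implicit Types (f : formpair) (i j k x y : Q).

(* In a pair f, f.1 goes with the product ⊣ and f.2 with ⊢. *)
Definition cocycle f := forall i j k,
  [/\ f.1 i (j ⊣ k) = f.1 i (j ⊢ k),
      f.1 (i ⊢ j) k = f.2 i (j ⊣ k),
      f.2 (i ⊣ j) k = f.2 (i ⊢ j) k,
      f.1 i (j ⊣ k) = f.1 (i ⊣ j) k
    & f.2 i (j ⊢ k) = f.2 (i ⊢ j) k].

Definition coboundary f := exists eps : 'Hom(Q, F^o), forall x y,
  f.1 x y = - eps (x ⊣ y) /\ f.2 x y = - eps (x ⊢ y).

Definition Z2 : {vspace formpair} := vspan cocycle.
Definition B2 : {vspace formpair} := vspan coboundary.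

(* Z2 / B2, as the image of Z2 in the space of all pairs modulo B2. *)
Definition H2 : {vspace vquot B2} := (linfun (@vpi F _ B2) @: Z2)%VS.

Lemma Z2P f : f \in Z2 <-> cocycle f.
Proof.
apply: vspanP; split=> [i j k|a u v Zu Zv i j k].
  by rewrite /= !zero_lfunE.
have [u1 u2 u3 u4 u5] := Zu i j k; have [v1 v2 v3 v4 v5] := Zv i j k.
rewrite /= !(add_lfunE, scale_lfunE) /=.
by split; congr (_ *: _ + _).
Qed.

Lemma B2P f : f \in B2 <-> coboundary f.
Proof.
apply: vspanP; split=> [|a u v [e ue] [d vd]].
  by exists 0 => x y; rewrite /= !zero_lfunE oppr0.
exists (a *: e + d) => x y; have [u1 u2] := ue x y; have [v1 v2] := vd x y.
rewrite /= !(add_lfunE, scale_lfunE) /= u1 u2 v1 v2.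
by rewrite !scalerN !opprD.
Qed.

Lemma B2_sub_Z2 : (B2 <= Z2)%VS.
Proof.
apply/subvP=> f /B2P[e fe]; apply/Z2P => i j k.
have f1 x y : f.1 x y = - e (x ⊣ y) by case: (fe x y).
have f2 x y : f.2 x y = - e (x ⊢ y) by case: (fe x y).
by rewrite !f1 !f2 ldia_lr rldiaA rdia_lr -rdiaA -ldiaA ldia_lr.
Qed.

Lemma dim_H2 : \dim H2 = (\dim Z2 - \dim B2)%N.
Proof.
rewrite /H2 -[in RHS](limg_ker_dim (linfun (@vpi F _ B2)) Z2).
suff -> : (Z2 :&: lker (linfun (@vpi F _ B2)) = B2)%VS by rewrite addKn.
apply/vspaceP=> f; rewrite memv_cap memv_ker lfunE /= vpi_eq0.
by apply: andb_idl; apply: (subvP B2_sub_Z2).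
Qed.

End Cohomology.

Arguments Z2 {F} Q.
Arguments B2 {F} Q.
Arguments H2 {F} Q.

(* Main.v *)
Require Import Defs.
From HB Require Import structures.
From mathcomp Require Import all_boot all_order all_algebra.
From mathcomp Require Import zify.

Set Implicit Arguments.
Unset Strict Implicit.
Unset Printing Implicit Defensive.

Import GRing.Theory.
Local Open Scope ring_scope.

(** Write [n = dim L], [l = dim L'], [w = n - l], and let [d] be the
    codimension of [L' + Z(L)].  Fix a complement [W] of [L'] and a complement
    [U] of [Z(L) + L'], so that [dim W = w] and [dim U = d].

    A cocycle vanishes on [Z(L) * L'] and on [L' * Z(L)], since the cocycle
    identities move one factor of the product in [L'] next to the central
    argument (lemma [cocycle_central]).  If it also vanishes on [U * L'] and
    [L' * U], then it vanishes on [L' * (L' :&: L^k)] for all [k], by descending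
    induction on [k]: a value at [(a1 . a2, c)] is a value at [(a1, a2 . c)],
    where [a2 . c] lies in [L' :&: L^(k+1)], and [a1] splits along
    [U + (Z(L) + L')] (lemma [cocycle_derived]).  So nilpotency makes a cocycle
    determined by its values on [W * W], [U * L'] and [L' * U], whence
    [dim Z^2(L) <= 2 w^2 + 4 d l] (lemma [dim_Z2_le]).

    On the other hand [dim B^2(L) >= l], because a linear form on [L'] is
    determined by its coboundary; and every pair of forms on the abelian algebra
    [L / L'] is a cocycle while its only coboundary is [0], so that
    [dim H^2(L / L') = 2 w^2].  Together these give
    [dim H^2(L) <= dim H^2(L / L') + l (4 d - 1)], and
    [d = dim (L / Z(L)) - dim (L / Z(L))']. *)

(** * Bilinear forms in coordinates *)

Section Restriction.
Variables (F : fieldType) (V : vectType F).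
Implicit Types (g : 'Hom(V, 'Hom(V, F^o))) (A B C : {vspace V}).

(** The restriction of a bilinear form to [A * B], as its matrix in the
    chosen bases of [A] and [B]. *)
Definition bilres A B g : 'M[F]_(\dim A, \dim B) :=
  \matrix_(i, j) g (vbasis A)`_i (vbasis B)`_j.

Fact bilres_is_linear A B : linear (bilres A B).
Proof. by move=> a f g; apply/matrixP=> i j; rewrite !mxE !lfunE /= !lfunE. Qed.
HB.instance Definition _ A B :=
  GRing.isLinear.Build F _ _ _ (bilres A B) (@bilres_is_linear A B).

Lemma bilres_eq0 A B g : bilres A B g = 0 ->
  {in A & B, forall x y, g x y = 0}.
Proof.
move=> /matrixP g0 x y /coord_vbasis -> /coord_vbasis ->.
rewrite (linear_sum g) sum_lfunE big1 // => i _.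
rewrite linear_sum big1 // => j _.
rewrite !linearZ /= lfunE /=.
by have := g0 i j; rewrite !mxE => ->; rewrite !scaler0.
Qed.

Lemma bilform0_addl A B C g :
  {in A & C, forall x y, g x y = 0} -> {in B & C, forall x y, g x y = 0} ->
  {in (A + B)%VS & C, forall x y, g x y = 0}.
Proof.
move=> gA gB _ y /memv_addP[a aA [b bB ->]] yC.
by rewrite linearD /= add_lfunE gA // gB // addr0.
Qed.

Lemma bilform0_addr A B C g :
  {in A & B, forall x y, g x y = 0} -> {in A & C, forall x y, g x y = 0} ->
  {in A & (B + C)%VS, forall x y, g x y = 0}.
Proof.
move=> gB gC x _ xA /memv_addP[b bB [c cC ->]].
by rewrite linearD /= gB // gC // addr0.
Qed.

End Restriction.

Lemma dimv_le_inj (F : fieldType) (V W : vectType F) (f : {linear V -> W})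
    (A : {vspace V}) (B : {vspace W}) :
  (forall v, v \in A -> f v \in B) ->
  (forall v, v \in A -> f v = 0 -> v = 0) ->
  (\dim A <= \dim B)%N.
Proof.
move=> fAB injf; have fA : (linfun f @: A <= B)%VS.
  by apply/subvP=> _ /memv_imgP[v vA ->]; rewrite lfunE fAB.
apply: leq_trans (dimvS fA); rewrite limg_dim_eq //.
apply/eqP; rewrite -subv0; apply/subvP=> v.
by rewrite memv_cap memv_ker lfunE memv0 => /andP[/injf vA /eqP/vA/eqP].
Qed.

(** * Cocycles of a nilpotent algebra *)

Section Cocycles.
Variables (F : fieldType) (L : diassocType F).
Local Notation bilform := 'Hom(L, 'Hom(L, F^o)).
Local Notation formpair := (bilform * bilform)%type.
Implicit Types (f : formpair) (A B : {vspace L}).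

Lemma derived_ind (P : L -> Prop) : lin_closed P ->
  (forall x y, P (x ⊣ y)) -> (forall x y, P (x ⊢ y)) ->
  forall z, z \in derived L -> P z.
Proof.
move=> linP Pl Pr _ /memv_addP[u uL [v vL ->]]; rewrite -[u]scale1r.
apply: linP.2; [move: u uL | move: v vL]; apply: vspan_ind => //;
  by move=> _ [x [y [_ _ ->]]].
Qed.

Lemma lcs_mul k x y : (0 < k)%N -> y \in lcs L k ->
  x ⊣ y \in lcs L k.+1 /\ x ⊢ y \in lcs L k.+1.
Proof.
move=> k_gt0 yk; rewrite lcsS // big_ltn // subn1 lcs1.
split; apply: (subvP (addvSl _ _)).
- by apply: (subvP (addvSl _ _)); apply: mem_vspan; exists x, y; rewrite memvf.
- by apply: (subvP (addvSr _ _)); apply: mem_vspan; exists x, y; rewrite memvf.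
Qed.

(** Both components of a pair of forms vanish on [A * B]. *)
Definition vanish f A B :=
  {in A & B, forall x y, f.1 x y = 0} /\ {in A & B, forall x y, f.2 x y = 0}.

Lemma vanish_addl f A1 A2 B :
  vanish f A1 B -> vanish f A2 B -> vanish f (A1 + A2)%VS B.
Proof. by move=> [? ?] [? ?]; split; apply: bilform0_addl. Qed.

Lemma vanish_addr f A B1 B2 :
  vanish f A B1 -> vanish f A B2 -> vanish f A (B1 + B2)%VS.
Proof. by move=> [? ?] [? ?]; split; apply: bilform0_addr. Qed.

Lemma vanish_subr f A B1 B2 :
  (B1 <= B2)%VS -> vanish f A B2 -> vanish f A B1.
Proof.
by move=> /subvP sB [f1 f2]; split=> x y xA /sB yB; [apply: f1 | apply: f2].
Qed.

Fact lin_closed_kerl f c : lin_closed (fun a => f.1 a c = 0 /\ f.2 a c = 0).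
Proof.
split=> [|k u v [u1 u2] [v1 v2]]; first by rewrite !linear0 !zero_lfunE.
by rewrite !linearP /= !lfunE /= !lfunE /= u1 u2 v1 v2 scaler0 addr0.
Qed.

Fact lin_closed_kerr f a : lin_closed (fun c => f.1 a c = 0 /\ f.2 a c = 0).
Proof.
split=> [|k u v [u1 u2] [v1 v2]]; first by rewrite !linear0.
by rewrite !linearP /= u1 u2 v1 v2 scaler0 addr0.
Qed.

(** The center and the derived algebra are orthogonal for every cocycle. *)
Lemma cocycle_central f : cocycle f ->
  vanish f (center L) (derived L) /\ vanish f (derived L) (center L).
Proof.
move=> Zf.
have zl z c : z \in center L -> c \in derived L ->
    f.1 z c = 0 /\ f.2 z c = 0.
  move=> /centerP Zz; move: c; apply: derived_ind => [|x y|x y].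
  - exact: lin_closed_kerr.
  - have [_ e2 _ e4 _] := Zf z x y; have [zx1 zx2 _ _] := Zz x.
    by rewrite e4 -e2 zx1 zx2 linear0 zero_lfunE.
  have [e1 _ _ e4 e5] := Zf z x y; have [zx1 zx2 _ _] := Zz x.
  by rewrite -e1 e4 e5 zx1 zx2 !linear0 !zero_lfunE.
have zr z c : z \in center L -> c \in derived L ->
    f.1 c z = 0 /\ f.2 c z = 0.
  move=> /centerP Zz; move: c; apply: derived_ind => [|x y|x y].
  - exact: lin_closed_kerl.
  - have [_ _ e3 e4 e5] := Zf x y z; have [_ _ yz1 yz2] := Zz y.
    by rewrite -e4 e3 -e5 yz1 yz2 !linear0.
  have [_ e2 _ _ e5] := Zf x y z; have [_ _ yz1 yz2] := Zz y.
  by rewrite e2 -e5 yz1 yz2 !linear0.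
split; split=> x y xA yB.
- by have [] := zl x y xA yB.
- by have [] := zl x y xA yB.
- by have [] := zr y x yB xA.
- by have [] := zr y x yB xA.
Qed.

(** The values of [f] on [L' * L'] reduce to those on [U * L'] and
    [Z(L) * L'], because [L] multiplies each [L^k] into [L^(k+1)]. *)
Lemma cocycle_derived f U : nilpotent L -> cocycle f ->
  (U + (center L + derived L))%VS = {:L}%VS ->
  vanish f U (derived L) -> vanish f (derived L) (derived L).
Proof.
move=> [N N_gt0 lcsN] Zf defL fU; have [fZ _] := cocycle_central Zf.
(* Descending induction on the exponent [N - j] of the lower central series. *)
have step j : (j < N)%N ->
    vanish f (derived L) (derived L :&: lcs L (N - j)).
  elim: j => [|j IHj] ltjN.
    rewrite subn0 lcsN capv0.
    by split=> x y _; rewrite memv0 => /eqP ->; rewrite linear0.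
  pose k := (N - j.+1)%N; have k_gt0 : (0 < k)%N by rewrite subn_gt0.
  have Dk : (N - j)%N = k.+1 by rewrite subnSK // ltnW.
  have [f1 f2] : vanish f {:L} (derived L :&: lcs L k.+1).
    rewrite -defL; do 2?[apply: vanish_addl].
    - exact: vanish_subr (capvSl _ _) fU.
    - exact: vanish_subr (capvSl _ _) fZ.
    by rewrite -Dk; apply: IHj; rewrite ltnW.
  have mulL x c : c \in lcs L k ->
      x ⊣ c \in (derived L :&: lcs L k.+1)%VS /\
      x ⊢ c \in (derived L :&: lcs L k.+1)%VS.
    move=> ck; have [xc1 xc2] := mem_derived x c.
    by have [xk1 xk2] := lcs_mul x k_gt0 ck; rewrite !memv_cap xc1 xc2 xk1 xk2.
  have f0 a c : a \in derived L -> c \in lcs L k -> f.1 a c = 0 /\ f.2 a c = 0.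
    move=> aL ck; move: a aL; apply: derived_ind => [|x y|x y].
    - exact: lin_closed_kerl.
    - have [_ _ e3 e4 e5] := Zf x y c; have [yc1 yc2] := mulL y c ck.
      by rewrite -e4 e3 -e5 f1 ?f2 ?memvf.
    have [_ e2 _ _ e5] := Zf x y c; have [yc1 yc2] := mulL y c ck.
    by rewrite e2 -e5 !f2 ?memvf.
  by split=> a c aL /memv_capP[_ ck]; have [] := f0 a c aL ck.
(* The last value of j gives the exponent 1, where [L' :&: L^1 = L']. *)
have := step N.-1; rewrite prednK // => /(_ (leqnn _)).
by rewrite -[X in (X - _)%N](prednK N_gt0) subSnn lcs1 capvf.
Qed.

Lemma dim_Z2_le : nilpotent L ->
  (\dim (Z2 L) <= 2 * (\dim (derived L)^C * \dim (derived L)^C) +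
     4 * (\dim (center L + derived L)^C * \dim (derived L)))%N.
Proof.
move=> nilL.
pose D := derived L; pose W := (D^C)%VS; pose U := ((center L + D)^C)%VS.
pose phi f := ((bilres W W f.1, bilres W W f.2),
  ((bilres U D f.1, bilres U D f.2), (bilres D U f.1, bilres D U f.2))).
have phi_lin : linear phi by move=> a f g; rewrite /phi /= !linearP.
pose phiL := GRing.isLinear.Build F _ _ _ phi phi_lin.
pose Phi : {linear _ -> _} := HB.pack phi phiL.
have: (\dim (Z2 L) <= \dim {:
  ((('M[F]_(\dim W, \dim W) * 'M[F]_(\dim W, \dim W)) *
  (('M[F]_(\dim U, \dim D) * 'M[F]_(\dim U, \dim D)) *
   ('M[F]_(\dim D, \dim U) * 'M[F]_(\dim D, \dim U))))%type)})%N.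
  apply: (@dimv_le_inj _ _ _ Phi) => [f _|f /Z2P Zf []]; first exact: memvf.
  move=> w1 w2 u1 u2 u3 u4.
  have defL : (U + (center L + D))%VS = {:L}%VS by rewrite addvC addv_complf.
  have defL' : (W + D)%VS = {:L}%VS by rewrite addvC addv_complf.
  have fUD : vanish f U D by split; apply: bilres_eq0.
  have fDU : vanish f D U by split; apply: bilres_eq0.
  have [fZD fDZ] := cocycle_central Zf.
  have fDD : vanish f D D := cocycle_derived nilL Zf defL fUD.
  have fLD : vanish f {:L} D by rewrite -defL; do 2?[apply: vanish_addl].
  have fDL : vanish f D {:L} by rewrite -defL; do 2?[apply: vanish_addr].
  have fWL : vanish f W {:L}.
    rewrite -defL'; apply: vanish_addr; first by split; apply: bilres_eq0.
    by case: fLD => f1 f2; split=> x y _ yD; rewrite (f1, f2) ?memvf.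
  have [f1 f2] : vanish f {:L} {:L} by rewrite -{1}defL'; apply: vanish_addl.
  by case: f f1 f2 {Zf w1 w2 u1 u2 u3 u4 fUD fDU fZD fDZ fDD fLD fDL fWL}
    => g h /= f1 f2;
    congr (_, _); apply/lfunP=> x; apply/lfunP=> y;
    rewrite !zero_lfunE (f1, f2) ?memvf.
rewrite dimvf => /leq_trans; apply.
suff -> : forall w d l, dim ((('M[F]_(w, w) * 'M[F]_(w, w)) *
    (('M[F]_(d, l) * 'M[F]_(d, l)) * ('M[F]_(l, d) * 'M[F]_(l, d))))%type)
    = (2 * (w * w) + 4 * (d * l))%N by [].
move=> w d l; transitivity (w * w + w * w + (d * l + d * l + (l * d + l * d)))%N.
  by [].
by lia.
Qed.

(** * Coboundaries *)

(** The linear forms [y |-> e (x ⊣ y)] and [y |-> e (x ⊢ y)]. *)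
Definition comp_ldia (e : 'Hom(L, F^o)) x := (e \o linfun (ldia x))%VF.
Definition comp_rdia (e : 'Hom(L, F^o)) x := (e \o linfun (rdia x))%VF.

Lemma comp_ldiaE e x y : comp_ldia e x y = e (x ⊣ y).
Proof. by rewrite comp_lfunE lfunE. Qed.

Lemma comp_rdiaE e x y : comp_rdia e x y = e (x ⊢ y).
Proof. by rewrite comp_lfunE lfunE. Qed.

Fact comp_ldia_is_linear e : linear (comp_ldia e).
Proof.
move=> a x y; apply/lfunP=> z.
by rewrite !(add_lfunE, scale_lfunE, comp_ldiaE) ldiaPl linearP.
Qed.
HB.instance Definition _ e :=
  GRing.isLinear.Build F _ _ _ (comp_ldia e) (comp_ldia_is_linear e).

Fact comp_rdia_is_linear e : linear (comp_rdia e).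
Proof.
move=> a x y; apply/lfunP=> z.
by rewrite !(add_lfunE, scale_lfunE, comp_rdiaE) rdiaPl linearP.
Qed.
HB.instance Definition _ e :=
  GRing.isLinear.Build F _ _ _ (comp_rdia e) (comp_rdia_is_linear e).

(** The pair of forms [e (x ⊣ y)], [e (x ⊢ y)]: the coboundary of [- e]. *)
Definition cobound e : formpair := (linfun (comp_ldia e), linfun (comp_rdia e)).

Lemma cobound1E e x y : (cobound e).1 x y = e (x ⊣ y).
Proof. by rewrite /= lfunE /= comp_ldiaE. Qed.

Lemma cobound2E e x y : (cobound e).2 x y = e (x ⊢ y).
Proof. by rewrite /= lfunE /= comp_rdiaE. Qed.

Fact cobound_is_linear : linear cobound.
Proof.
move=> a e d; congr (_, _); apply/lfunP=> x; apply/lfunP=> y.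
  by rewrite /= !(add_lfunE, scale_lfunE) ![linfun _ x]lfunE !comp_ldiaE
    add_lfunE scale_lfunE.
by rewrite /= !(add_lfunE, scale_lfunE) ![linfun _ x]lfunE !comp_rdiaE
    add_lfunE scale_lfunE.
Qed.
HB.instance Definition _ :=
  GRing.isLinear.Build F _ _ _ cobound cobound_is_linear.

Lemma cobound_B2 e : cobound e \in B2 L.
Proof.
apply/B2P; exists (- e) => x y.
by rewrite cobound1E cobound2E !opp_lfunE !opprK.
Qed.

(** A linear form on [L'] is determined by its coboundary. *)
Lemma dim_B2_ge : (\dim (derived L) <= \dim (B2 L))%N.
Proof.
pose D := derived L.
pose phi (e : 'Hom(subvs_of D, F^o)) := cobound (e \o linfun (vsproj D))%VF.
have phi_lin : linear phi.
  by move=> a e d; rewrite /phi comp_lfunDl -comp_lfunZl linearP.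
pose phiL := GRing.isLinear.Build F _ _ _ phi phi_lin.
pose Phi : {linear _ -> _} := HB.pack phi phiL.
have <- : \dim {: 'Hom(subvs_of D, F^o)} = \dim D.
  by rewrite dimvf -[RHS]muln1.
apply: (@dimv_le_inj _ _ _ Phi) => [e _|e _]; first exact: cobound_B2.
rewrite [LHS]/(phi e) /phi => e0.
have eD : forall z, z \in D -> e (vsproj D z) = 0.
  apply: derived_ind => [|x y|x y].
  - by split=> [|a u v eu ev]; rewrite ?linear0 // !linearP /= eu ev scaler0 addr0.
  - have := cobound1E (e \o linfun (vsproj D))%VF x y.
    by rewrite e0 !zero_lfunE comp_lfunE lfunE.
  have := cobound2E (e \o linfun (vsproj D))%VF x y.
  by rewrite e0 !zero_lfunE comp_lfunE lfunE.
apply/lfunP=> z; rewrite zero_lfunE -[z]vsvalK.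
exact: eD (subvsP z).
Qed.

(** Every pair of forms on an abelian algebra is a cocycle, and only [0] is a
    coboundary. *)
Lemma dim_H2_abelian : derived L = 0%VS ->
  \dim (H2 L) = (2 * (\dim {:L} * \dim {:L}))%N.
Proof.
move=> L0; have mul0 (x y : L) : x ⊣ y = 0 /\ x ⊢ y = 0.
  by have := mem_derived x y; rewrite L0 !memv0 => -[/eqP -> /eqP ->].
have ldia0 (x y : L) : x ⊣ y = 0 by case: (mul0 x y).
have rdia0 (x y : L) : x ⊢ y = 0 by case: (mul0 x y).
have B0 : B2 L = 0%VS.
  apply/eqP; rewrite -subv0; apply/subvP=> f /B2P[e fe].
  rewrite memv0; apply/eqP; case: f fe => g h fe.
  by congr (_, _); apply/lfunP=> x; apply/lfunP=> y; have [/= gxy hxy] := fe x y;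
    rewrite ?gxy ?hxy ?ldia0 ?rdia0 !zero_lfunE linear0 oppr0.
have Z1 : Z2 L = fullv.
  apply/eqP; rewrite eqEsubv subvf; apply/subvP=> f _; apply/Z2P => i j k.
  by rewrite !ldia0 !rdia0 !linear0 !zero_lfunE.
rewrite dim_H2 B0 Z1 dimv0 subn0 !dimvf.
by rewrite mul2n -addnn -[X in (_ * X + _)%N]muln1 -[X in (_ + _ * X)%N]muln1.
Qed.

End Cocycles.

(** * Quotients *)

Lemma lin_closed_mem (F : fieldType) (V W : vectType F) (f : {linear V -> W})
  (A : {vspace W}) : lin_closed (fun v => f v \in A).
Proof.
by split=> [|a u v uA vA]; rewrite ?linear0 ?mem0v // linearP memvD ?memvZ.
Qed.

Section Quotients.
Variables (F : fieldType) (L : diassocType F).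
Implicit Types I : ideal L.

Lemma derived_diaquot I :
  derived (diaquot I) = (linfun (@diapi F L I) @: derived L)%VS.
Proof.
apply/vspaceP=> q; apply/idP/idP.
  move: q; apply: derived_ind => [|p q|p q].
  - exact: (lin_closed_mem idfun).
  - have [x ->] := diapi_surj p; have [y ->] := diapi_surj q.
    rewrite -diapi_ldia -[diapi I _](lfunE (diapi I)) memv_img //.
    by have [] := mem_derived x y.
  have [x ->] := diapi_surj p; have [y ->] := diapi_surj q.
  rewrite -diapi_rdia -[diapi I _](lfunE (diapi I)) memv_img //.
  by have [] := mem_derived x y.
case/memv_imgP=> x xL ->; rewrite lfunE /=.
move: x xL; apply: derived_ind => [|x y|x y]; first exact: lin_closed_mem.
- by rewrite diapi_ldia; have [] := mem_derived (diapi I x) (diapi I y).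
- by rewrite diapi_rdia; have [] := mem_derived (diapi I x) (diapi I y).
Qed.

Lemma dim_derived_diaquot I :
  (\dim (derived L :&: I) + \dim (derived (diaquot I)) = \dim (derived L))%N.
Proof.
rewrite derived_diaquot -(limg_ker_dim (linfun (@diapi F L I)) (derived L)).
congr (\dim (_ :&: _) + _)%N.
by apply/vspaceP=> x; rewrite memv_ker lfunE /= diapi_eq0.
Qed.

Lemma derived_abelianization : derived (diaquot (derived_ideal L)) = 0%VS.
Proof.
apply/eqP; rewrite -dimv_eq0; have := dim_derived_diaquot (derived_ideal L).
by rewrite capvv; lia.
Qed.

End Quotients.

Theorem corollary4p5 (F : fieldType) (L : diassocType F)
  (nilL : nilpotent L) :
  ((\dim (H2 L))%:Z <=
     (\dim (H2 (diaquot (derived_ideal L))))%:Z +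
     (\dim (derived L))%:Z *
       (4%:Z * (\dim {: diaquot (center_ideal L)})%:Z
        - 4%:Z * (\dim (derived (diaquot (center_ideal L))))%:Z - 1))%R.
Proof.
rewrite (dim_H2_abelian (derived_abelianization L)) dim_H2 !dim_diaquot /=.
have := dim_Z2_le nilL; have := dim_B2_ge L; have := dimvS (B2_sub_Z2 L).
have := dim_derived_diaquot (center_ideal L).
have := dimv_sum_cap (center L) (derived L).
rewrite !dimv_compl capvC /=.
have := dimvS (subvf (derived L)); have := dimvS (subvf (center L)).
have := dimvS (subvf (center L + derived L)).
set n := \dim fullv; set l := \dim (derived L); set z := \dim (center L).
set s := \dim (_ + _); set c := \dim (_ :&: _); set q := \dim (derived _).
move=> sn zn ln Ds Dl BZ lB.
(* [s = dim (Z(L) + L')], so [n - s] is the dimension [d] of [U]. *)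
have -> : 4%:Z * (n - z)%N%:Z - 4%:Z * q%:Z - 1 = 4%:Z * (n - s)%N%:Z - 1 by lia.
set w := (n - l)%N; set d := (n - s)%N => Zle.
by nia.
Qed.
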